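(* For Matching in the Late Accept/Reject model, Algorithm 2 (defined in the context) is strictly $3/2$-competitive; that is, Algorithm 2 is a valid algorithm in the Late Accept/Reject model (no late-rejected edge is ever accepted again), and for every input $\sigma$ the matching $M$ it holds after processing $\sigma$ satisfies $\mathrm{OPT}(\sigma)\le \frac32|M|$.
   Context: Online Matching (edge arrival). An input $\sigma$ is a finite simple undirected graph $G=(V,E)$ together with an ordering of its edges. Edges arrive one by one in this order; endpoints not seen before are revealed with the edge. The algorithm maintains a set of currently accepted edges, which must be a matching (pairwise non-incident edges). $\mathrm{OPT}(\sigma)$ is the maximum cardinality of a matching in $G$; the objective is maximization. Late Accept/Reject model: in each step the algorithm may accept the newly arrived edge and any earlier edges that have not been late-rejected, and it may remove (late-reject) accepted edges; a late-rejected edge can never be accepted again. For a matching $M$, a path with edges $e_1,\dots,e_k$ is alternating with respect to $M$ if, for all $i$, $e_i\in M$ if and only if $i$ is even; an alternating path is augmenting if neither endpoint of the path is incident to an edge of $M$. Algorithm 2. Initially $M=\emptyset$. When an edge $e$ arrives: if $M\cup\{e\}$ is a matching, set $M:=M\cup\{e\}$; then, if the graph revealed so far contains an augmenting path $xuvy$ of length $3$ with respect to $M$ (so $uv\in M$, $xu,vy\notin M$, and $x\neq y$ are unmatched), choose one such path and set $M:=(M\cup\{ux,vy\})-\{uv\}$. *)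

(* Defs.v *)
From mathcomp Require Import all_boot all_order all_algebra.

Set Implicit Arguments.
Unset Strict Implicit.
Unset Printing Implicit Defensive.

(* An undirected edge is a two-element set of vertices.  A finite simple
   graph with vertices in V, together with an ordering of its edges, is a
   repetition-free sequence of edges; its prefixes are the revealed graphs. *)
Definition is_input (V : finType) (s : seq {set V}) : bool :=
  uniq s && all (fun e : {set V} => #|e| == 2) s.

Definition matching (V : finType) (s : seq {set V}) (M : {set {set V}}) : bool :=
  (M \subset s) && trivIset M.

Definition OPT (V : finType) (s : seq {set V}) : nat :=
  \max_(M : {set {set V}} | matching s M) #|M|.

(* A deterministic online algorithm, given by the set of accepted edges that
   it holds after each sequence of arrivals. *)
Definition online_algorithm (V : finType) := seq {set V} -> {set {set V}}.

(* While s is processed, e is accepted after k arrivals, and is removed in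
   the next step. *)
Definition late_rejected (V : finType) (A : online_algorithm V)
    (s : seq {set V}) (e : {set V}) : Prop :=
  exists k, [/\ k < size s, e \in A (take k s) & e \notin A (take k.+1 s)].

(* Every prefix of an input is an input, so these conditions hold at every
   time step.  An edge that has arrived and has not been late-rejected may be
   accepted at any time, whether or not it was accepted on arrival. *)
Definition late_accept_reject (V : finType) (A : online_algorithm V) : Prop :=
  forall s : seq {set V}, is_input s ->
    matching s (A s) /\ (forall e, late_rejected A s e -> e \notin A s).

(* Competitiveness without additive constant, for a maximization problem. *)
Definition strictly_competitive (V : finType) (c : rat)
    (A : online_algorithm V) : Prop :=
  forall s : seq {set V}, is_input s ->
    ((OPT s)%:R <= c * #|A s|%:R)%R.

Definition path_edges (V : finType) (x : V) (p : seq V) : seq {set V} :=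
  pairmap (fun u v => [set u; v]) x p.

Definition simple_path (V : finType) (s : seq {set V}) (x : V) (p : seq V) : bool :=
  path (fun u v => [set u; v] \in s) x p && uniq (x :: p).

(* The edges e_1, ..., e_k of the path are numbered from 0 here, so that
   "e_i is in M iff i is even" becomes "odd i". *)
Definition alternating (V : finType) (M : {set {set V}}) (x : V) (p : seq V) : bool :=
  [forall i : 'I_(size p), (nth set0 (path_edges x p) i \in M) == odd i].

Definition augmenting (V : finType) (s : seq {set V}) (M : {set {set V}})
    (x : V) (p : seq V) : bool :=
  [&& simple_path s x p, alternating M x p,
      x \notin cover M & last x p \notin cover M].

(* How the algorithm chooses an augmenting path x u v y of length 3 (None if
   there is none), from the arrivals so far and the current matching.  The
   algorithm leaves this choice open, hence the parameter. *)
Definition path_rule (V : finType) :=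
  seq {set V} -> {set {set V}} -> option (V * V * V * V).

Definition correct_rule (V : finType) (r : path_rule V) : Prop :=
  forall (s : seq {set V}) (M : {set {set V}}),
    match r s M return Prop with
    | Some (x, u, v, y) => augmenting s M x [:: u; v; y]
    | None => forall x u v y, ~~ augmenting s M x [:: u; v; y]
    end.

(* s is the sequence of arrivals up to and including e. *)
Definition alg2_step (V : finType) (r : path_rule V) (s : seq {set V})
    (e : {set V}) (M : {set {set V}}) : {set {set V}} :=
  let M1 := if matching s (e |: M) then e |: M else M in
  match r s M1 with
  | Some (x, u, v, y) => (M1 :|: [set [set u; x]; [set v; y]]) :\ [set u; v]
  | None => M1
  end.

Fixpoint alg2_from (V : finType) (r : path_rule V) (past : seq {set V})
    (M : {set {set V}}) (future : seq {set V}) : {set {set V}} :=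
  if future is e :: future' then
    alg2_from r (rcons past e) (alg2_step r (rcons past e) e M) future'
  else M.

Definition algorithm2 (V : finType) (r : path_rule V) : online_algorithm V :=
  alg2_from r [::] set0.

Lemma algorithm2_nil (V : finType) (r : path_rule V) : algorithm2 r [::] = set0.
Proof. by []. Qed.

Lemma algorithm2_rcons (V : finType) (r : path_rule V) (s : seq {set V}) (e : {set V}) :
  algorithm2 r (rcons s e) = alg2_step r (rcons s e) e (algorithm2 r s).
Proof.
rewrite /algorithm2 -[in alg2_step _ _]/([::] ++ rcons s e).
by elim: s [::] set0 => [|f s IHs] past M /=; rewrite ?cats1 // IHs cat_rcons.
Qed.

Lemma correct_rule_exists (V : finType) : exists r : path_rule V, correct_rule r.
Proof.
exists (fun s M => [pick q : V * V * V * V |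
  augmenting s M q.1.1.1 [:: q.1.1.2; q.1.2; q.2]]) => s M.
case: pickP => [[[[x u] v] y] //|noq x u v y].
by rewrite (noq (x, u, v, y)).
Qed.

(* Main.v *)
(* Vertices covered by the matching M stay covered, every revealed edge meets
   the cover of M, and after each step no augmenting path of length 3 is left:
   a new one would have to use either the edge that just arrived, both of whose
   ends are then covered, or, as its middle edge, an edge just put into M, which
   would place a revealed edge between two previously uncovered vertices.  A late-rejected
   edge lies inside the cover, whereas every edge that the algorithm accepts is
   new or has an uncovered end, so it is never accepted again.  For the ratio,
   let O be any matching.  The edges of O with just one covered end inject into
   M, because two of them at the same edge of M would give an augmenting path of
   length 3; and the edges of O have at most 2|M| covered ends altogether.
   Adding up, 2|O| <= 3|M|. *)

Require Import Defs.
From mathcomp Require Import all_boot all_order all_algebra.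

Set Implicit Arguments.
Unset Strict Implicit.
Unset Printing Implicit Defensive.

Import GRing.Theory Num.Theory.

(** * Augmenting paths of length 3 and covers of matchings *)

Section Augmentation.

Variable V : finType.
Implicit Types (s : seq {set V}) (M O : {set {set V}}) (e f : {set V}).
Implicit Types x y u v : V.

(** Each outer edge has an end outside [cover M], hence is not in [M]; alternation thus reduces to
    the middle edge. *)
Lemma aug3E s M x u v y :
  augmenting s M x [:: u; v; y] =
  [&& [&& [set x; u] \in s, [set u; v] \in s & [set v; y] \in s],
      uniq [:: x; u; v; y], [set u; v] \in M, x \notin cover M
    & y \notin cover M].
Proof.
have notin_cover z w (e : {set V}) :
    e = [set z; w] -> z \notin cover M -> e \in M = false.
  move=> -> /bigcupP zM; apply/negP => eM; apply: zM.
  by exists [set z; w]; rewrite ?set21.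
rewrite /augmenting /simple_path; case: (boolP (x \in cover M)) => xM.
  by rewrite !andbF.
rewrite [last _ _]/=; case: (boolP (y \in cover M)) => yM.
  by rewrite !andbF.
have altE: alternating M x [:: u; v; y] = ([set u; v] \in M).
  apply/forallP/idP => [/(_ (@Ordinal 3 1 isT)) /= /eqP // | uvM].
  case=> [[|[|[|i]]]] //= lti; first by rewrite (notin_cover x u).
    by rewrite uvM.
  by rewrite (notin_cover y v) // setUC.
by rewrite altE /= !andbT -!andbA.
Qed.

Lemma coverU1 e M : cover (e |: M) = e :|: cover M.
Proof. by rewrite /cover bigcup_setU big_set1. Qed.

Lemma disjoint_set2 x y (A : {set V}) :
  [disjoint [set x; y] & A] = (x \notin A) && (y \notin A).
Proof. by rewrite disjoints_subset subUset !sub1set !inE. Qed.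

Lemma sub_cover e M : e \in M -> e \subset cover M.
Proof. by move=> eM; apply: (bigcup_max e). Qed.

Lemma trivIset_addU1 e M :
  trivIset M -> [disjoint e & cover M] -> trivIset (e |: M).
Proof. by move=> tM deM; apply: trivIsetU; rewrite ?cover1 // trivIset1. Qed.

Lemma disjoint_cover e M :
  trivIset (e |: M) -> e \notin M -> [disjoint e & cover M].
Proof.
move=> /trivIsetP tM eM; apply/bigcup_disjointP => f fM.
apply: tM; rewrite ?setU11 ?setU1r //.
by apply: contraNneq eM => ->.
Qed.

(** Spelled exactly as in [alg2_step], so that the two agree by conversion. *)
Definition flip M x u v y : {set {set V}} :=
  (M :|: [set [set u; x]; [set v; y]]) :\ [set u; v].

Lemma flipE M x u v y : uniq [:: x; u; v; y] ->
  flip M x u v y = [set x; u] |: ([set v; y] |: (M :\ [set u; v])).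
Proof.
move=> /= /and4P[]; rewrite !inE !negb_or => /and3P[xu xv xy] /andP[uv uy] vy _.
rewrite /flip [[set u; x]]setUC.
apply/setP => e; rewrite !inE.
case: (eqVneq e [set x; u]) => [->|_].
  rewrite /= !orbT andbT; apply/eqP => /setP/(_ x); rewrite !inE eqxx /=.
  by rewrite (negPf xu) (negPf xv).
case: (eqVneq e [set v; y]) => [->|_].
  rewrite /= !orbT andbT; apply/eqP => /setP/(_ y); rewrite !inE eqxx orbT.
  by rewrite eq_sym (negPf uy) eq_sym (negPf vy).
by rewrite !orbF.
Qed.

(** The ends [u] and [v] of the removed edge are covered again by the two new edges. *)
Lemma cover_flip s M x u v y :
  trivIset M -> augmenting s M x [:: u; v; y] ->
  trivIset (flip M x u v y) /\ cover (flip M x u v y) = x |: (y |: cover M).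
Proof.
move=> tM; rewrite aug3E => /and5P[_ Uq uvM xM yM].
rewrite flipE // !coverU1 coverD1 //.
have sub: [set u; v] \subset cover M by apply: sub_cover.
move: Uq => /= /and4P[]; rewrite !inE !negb_or => /and3P[xu xv xy].
case/andP=> uv uy vy _; split; last first.
  have [uM vM] : u \in cover M /\ v \in cover M.
    by split; apply: (subsetP sub); rewrite !inE eqxx ?orbT.
  apply/setP => z; rewrite !inE.
  case: (eqVneq z x) => //= _; case: (eqVneq z y) => //= _; rewrite ?orbT //.
  case: (eqVneq z u) => [->|_] //=; case: (eqVneq z v) => [->|_] //=.
apply: trivIset_addU1; first apply: trivIset_addU1.
- by apply: trivIsetS tM; apply: subsetDl.
- rewrite coverD1 // disjoint_set2 !inE ?eqxx ?orbT //.
  by rewrite (negPf yM) andbF.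
rewrite coverU1 coverD1 // disjoint_set2.
rewrite !inE ?eqxx ?orbT ?negb_or ?xv ?xy ?uv ?uy //.
by rewrite (negPf xM) andbF.
Qed.

(** * The invariant and its preservation *)

Definition maximal s M := {in s, forall e, ~~ [disjoint e & cover M]}.

Definition stable s M : Prop :=
  [/\ matching s M, maximal s M
    & forall x u v y, ~~ augmenting s M x [:: u; v; y]].

Lemma maximal_free s M x y :
  maximal s M -> x \notin cover M -> y \notin cover M -> [set x; y] \notin s.
Proof.
move=> maxM xM yM; apply/negP => /maxM /negP; apply.
by rewrite disjoint_set2 xM.
Qed.

Lemma stable_flip s M e x u v y :
  stable s M -> ~~ [disjoint e & cover M] ->
  augmenting (rcons s e) M x [:: u; v; y] -> stable (rcons s e) (flip M x u v y).
Proof.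
move=> [/andP[sM tM] maxM noaug] eM aug.
have maxM' : maximal (rcons s e) M.
  by move=> f; rewrite mem_rcons inE => /orP[/eqP->|/maxM].
have [tM' cM'] := cover_flip tM aug.
have subc : cover M \subset cover (flip M x u v y) by rewrite cM' !setUA subsetUr.
have freeM z : z \notin cover (flip M x u v y) -> z \notin cover M.
  by apply: contra => /(subsetP subc).
move: (aug); rewrite aug3E => /and5P[/and3P[xuE uvE vyE] Uq uvM xM yM].
have flipD := flipE M Uq.
split.
- rewrite /matching tM' andbT; apply/subsetP => f; rewrite flipD !inE.
  case/or3P=> [/eqP->|/eqP->|/andP[_ fM]] //.
  by rewrite mem_rcons inE (subsetP sM) ?orbT.
- by move=> f /maxM'; apply: contra => /(disjointWr subc).
move=> x' u' v' y'; apply/negP; rewrite aug3E.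
case/and5P=> /and3P[xuE' uvE' vyE'] Uq' uvM' xM' yM'.
(* Otherwise the whole path lies in [s] and was augmenting before [e] arrived. *)
have e_end : (e == [set x; u]) || (e == [set v; y]).
  have := noaug x u v y; rewrite aug3E Uq uvM xM yM !andbT (subsetP sM _ uvM) /=.
  move: xuE vyE; rewrite !mem_rcons !inE ![e == _]eq_sym.
  by case/orP=> [->|->] //; case/orP=> [->|->]; rewrite ?orbT.
have e_cov : e \subset cover (flip M x u v y).
  have xuF : [set x; u] \in flip M x u v y by rewrite flipD !inE eqxx.
  have vyF : [set v; y] \in flip M x u v y by rewrite flipD !inE eqxx orbT.
  by case/orP: e_end => /eqP ->; apply: sub_cover.
have ne_e z w : z \notin cover (flip M x u v y) ->
    [set z; w] \in rcons s e -> [set z; w] \in s.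
  move=> zM; rewrite mem_rcons inE => /orP[/eqP ezw|//].
  by case/negP: zM; apply: (subsetP e_cov); rewrite -ezw set21.
(* Both [x] and [y] were uncovered by [M], so such an edge would violate [maxM']. *)
have no_free z w : z \notin cover (flip M x u v y) ->
    [set z; w] \in rcons s e -> w \in [set x; y] -> False.
  move=> /freeM zM zwE wxy.
  have wM : w \notin cover M by case/set2P: wxy => ->.
  by have /negP := maximal_free maxM' zM wM.
rewrite flipD !inE in uvM'.
case/or3P: uvM' => [/eqP uvxu|/eqP uvvy|/andP[_ uvM'']].
(* If the middle edge is new, it contains [x] or [y], and one of the outer edges joins that vertex
   to [x'] or [y']. *)
- have : x \in [set u'; v'] by rewrite uvxu set21.
  case/set2P => xE.
    by apply: (no_free _ _ xM' xuE'); rewrite xE set21.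
  by apply: (no_free y' v' yM'); rewrite ?xE ?set21 // setUC.
- have : y \in [set u'; v'] by rewrite uvvy set22.
  case/set2P => yE.
    by apply: (no_free _ _ xM' xuE'); rewrite yE set22.
  by apply: (no_free y' v' yM'); rewrite ?yE ?set22 // setUC.
(* With an old middle edge, the second path was already augmenting for [M] in [s]. *)
have /negP[] := noaug x' u' v' y'.
rewrite aug3E Uq' uvM'' !freeM // (subsetP sM _ uvM'') (ne_e _ _ xM' xuE') /=.
by rewrite setUC (ne_e y' v') // setUC.
Qed.

Lemma stable_addU1 s M e :
  e != set0 -> stable s M -> [disjoint e & cover M] ->
  stable (rcons s e) (e |: M).
Proof.
move=> e0 [/andP[sM tM] maxM noaug] deM.
split.
- rewrite /matching trivIset_addU1 // andbT; apply/subsetP => f.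
  by rewrite !inE mem_rcons inE => /orP[->//|/(subsetP sM)->]; rewrite orbT.
- move=> f; rewrite mem_rcons inE coverU1 => /orP[/eqP->|/maxM].
    (* Being nonempty, [e] meets the cover that now includes it. *)
    apply: contra e0 => /(disjointWr (subsetUl _ _)).
    by rewrite -setI_eq0 setIid.
  by apply: contra => /(disjointWr (subsetUr _ _)).
move=> x u v y; apply/negP; rewrite aug3E coverU1 !inE !negb_or.
case/and5P=> /and3P[xuE _ vyE] Uq uvM /andP[xe xM] /andP[ye yM].
have ne_e z w : z \notin e -> [set z; w] \in rcons s e -> [set z; w] \in s.
  move=> ze; rewrite mem_rcons inE => /orP[/eqP ezw|//].
  by rewrite -ezw set21 in ze.
have xus := ne_e _ _ xe xuE.
(* If the middle edge is [e], then [u] was uncovered by [M], and the old edge [xu] had two uncovered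
   ends. *)
case/orP: uvM => [/eqP uve|uvM].
  have uM : u \notin cover M.
    by rewrite (disjointFr deM) // -uve set21.
  by have /negP := maximal_free maxM xM uM.
have /negP[] := noaug x u v y.
rewrite aug3E Uq uvM xM yM xus (subsetP sM _ uvM) /=.
by rewrite setUC (ne_e y v) // setUC.
Qed.

Lemma stable_nil : stable [::] set0.
Proof.
split=> [|//|x u v y]; last by rewrite aug3E in_nil.
by apply/andP; split; [apply/subsetP => A | apply/trivIsetP => A B]; rewrite inE.
Qed.

(** * A single step of the algorithm *)

(** No case adds [e] and then flips: by [stable_addU1], adding [e] leaves no augmenting path of
    length 3. *)
Variant step_spec s e M M' : Prop :=
  | StepKeep of M' = M
  | StepAdd of M' = e |: M
  | StepFlip x u v y of augmenting (rcons s e) M x [:: u; v; y]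
      & M' = flip M x u v y.

Lemma alg2_stepP (r : path_rule V) s e M :
  correct_rule r -> e \notin s -> e != set0 -> stable s M ->
  step_spec s e M (alg2_step r (rcons s e) e M) /\
  stable (rcons s e) (alg2_step r (rcons s e) e M).
Proof.
move=> hr es e0 stM; have [/andP[sM tM] maxM noaug] := stM.
have eM : e \notin M by apply: contra es => /(subsetP sM).
have addE : matching (rcons s e) (e |: M) = [disjoint e & cover M].
  apply/andP/idP => [[_ teM]|deM]; first exact: disjoint_cover.
  by have [/andP] := stable_addU1 e0 stM deM.
rewrite /alg2_step addE; case: (boolP [disjoint e & cover M]) => deM.
  have := stable_addU1 e0 stM deM => st'.
  have := hr (rcons s e) (e |: M); case: (r _ _) => [[[[x u] v] y]|_].
    by case: st' => _ _ /(_ x u v y) /negPf ->.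
  by split=> //; apply: StepAdd.
have := hr (rcons s e) M; case: (r _ _) => [[[[x u] v] y] aug|noaug'].
  by split; [apply: StepFlip aug _ | apply: stable_flip].
split; first exact: StepKeep.
split=> //.
  rewrite /matching tM andbT; apply/subsetP => f /(subsetP sM).
  by rewrite mem_rcons inE orbC => ->.
by move=> f; rewrite mem_rcons inE => /orP[/eqP->|/maxM].
Qed.

(** * Late-rejected edges are never accepted again *)

(* The state in which late rejection leaves an edge; no step leaves it. *)
Definition barred s M e := [&& e \in s, e \notin M & e \subset cover M].

(** The cover only grows, and an edge entering the matching is [e] or contains one of the uncovered
    vertices [x], [y]. *)
Lemma barred_step s e M M' f :
  e \notin s -> trivIset M -> step_spec s e M M' ->
  barred s M f -> barred (rcons s e) M' f.
Proof.
move=> es tM spec /and3P[fs fM fc].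
have fe : f != e by apply: contraNneq es => <-.
rewrite /barred mem_rcons inE fs orbT /=.
case: spec => [->|->|x u v y aug ->]; first by rewrite fM.
  by rewrite coverU1 !inE (negPf fe) fM (subset_trans fc) ?subsetUr.
have [_ ->] := cover_flip tM aug.
move: aug; rewrite aug3E => /and5P[_ Uq _ xM yM].
rewrite flipE // !inE (negPf fM) andbF orbF negb_or !setUA.
rewrite (subset_trans fc) ?subsetUr // andbT.
apply/andP; split; [move: xM|move: yM]; apply: contraNneq => fE.
  by apply: (subsetP fc); rewrite fE set21.
by apply: (subsetP fc); rewrite fE set22.
Qed.

Lemma removed_barred s e M M' f :
  matching s M -> step_spec s e M M' -> f \in M -> f \notin M' ->
  barred (rcons s e) M' f.
Proof.
move=> /andP[sM tM] spec fM fM'.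
rewrite /barred mem_rcons inE (subsetP sM) // orbT fM' /=.
have fc : f \subset cover M by apply: sub_cover.
apply: (subset_trans fc).
case: spec => [->|->|x u v y aug ->] //; first by rewrite coverU1 subsetUr.
by have [_ ->] := cover_flip tM aug; rewrite !setUA subsetUr.
Qed.

Lemma is_input_rcons s e :
  is_input (rcons s e) -> [/\ is_input s, e \notin s & e != set0].
Proof.
rewrite /is_input rcons_uniq all_rcons => /andP[/andP[es ->] /andP[/eqP e2 ->]].
by split=> //; rewrite -card_gt0 e2.
Qed.

Lemma algorithm2_stable (r : path_rule V) s :
  correct_rule r -> is_input s -> stable s (algorithm2 r s).
Proof.
move=> hr; elim/last_ind: s => [|s e IHs]; first by move=> _; apply: stable_nil.
case/is_input_rcons=> /IHs stM es e0.
by rewrite algorithm2_rcons; case: (alg2_stepP hr es e0 stM).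
Qed.

Lemma late_rejected_barred (r : path_rule V) s f :
  correct_rule r -> is_input s -> late_rejected (algorithm2 r) s f ->
  barred s (algorithm2 r s) f.
Proof.
move=> hr; elim/last_ind: s => [|s e IHs]; first by move=> _ [k []].
case/is_input_rcons=> ins es e0 [k [ltk]].
have stM := algorithm2_stable hr ins; have [mM _ _] := stM.
have [spec _] := alg2_stepP hr es e0 stM.
(* For [k = size s] the rejection happens on the arrival of [e]; otherwise it happened within
   [s]. *)
move: ltk; rewrite size_rcons ltnS leq_eqVlt => /orP[/eqP->|ltk].
  rewrite -cats1 take_size_cat // cats1 take_oversize ?size_rcons //.
  by rewrite algorithm2_rcons; apply: removed_barred.
rewrite -cats1 !takel_cat ?(ltnW ltk) // cats1 => fin fout.
rewrite algorithm2_rcons; apply: (barred_step es _ spec); first by case/andP: mM.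
by apply: IHs => //; exists k.
Qed.

(** * The competitive ratio *)

(** Each edge of [O] is charged its number of covered ends, plus 1 if some end is uncovered; this is
    at least 2 per edge. *)
Lemma stable_card s M O :
  is_input s -> stable s M -> matching s O -> 2 * #|O| <= 3 * #|M|.
Proof.
case/andP=> _ /allP s2 [/andP[sM tM] maxM noaug] /andP[sO tO].
have card2 e : e \in s -> #|e| = 2 by move/s2/eqP.
(* By maximality these edges have exactly one covered end. *)
pose O1 := [set e in O | ~~ (e \subset cover M)].
have O1P e : e \in O1 -> exists x u,
    [/\ e = [set x; u], e \in s, x \notin cover M & u \in cover M].
  rewrite inE => /andP[/(subsetP sO) es]; case/subsetPn => x xe xM.
  have /pred0Pn[u /andP[/= ue uM]] := maxM e es.
  exists x, u; split=> //; apply/esym/eqP; rewrite eqEcard card2 //.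
  rewrite subUset !sub1set xe ue cards2; case: eqP xM => // ->.
  by rewrite uM.
(* [F] picks an edge of [M] meeting [e]; the default [set0] does not occur on [O1]. *)
pose F e := odflt set0 [pick m in M | ~~ [disjoint m & e]].
have FP e : e \in O1 -> F e \in M /\ ~~ [disjoint F e & e].
  move=> /O1P[x [u [-> _ _ /bigcupP[m mM um]]]]; rewrite /F.
  case: pickP => [m' /andP[//]|/(_ m)]; rewrite mM /=.
  by move/negbFE/disjointFr/(_ um); rewrite set22.
have FE x u : x \notin cover M -> [set x; u] \in O1 -> u \in F [set x; u].
  move=> xM /FP[FM /pred0Pn[z /andP[/= zF]]] /set2P[] zE; rewrite zE in zF => //.
  by case/negP: xM; apply: (subsetP (sub_cover FM)).
have leO1 : #|O1| <= #|M|.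
  rewrite -(card_in_imset (f := F) (D := O1)).
    by apply/subset_leq_card/subsetP => _ /imsetP[e /FP[FM _] ->].
  (* If [e = xu] and [f = vy] are distinct with the same image, that image is [uv], and [xuvy] is
     augmenting. *)
  move=> e f e1 f1 eqF; apply/eqP; apply: contraT => nef.
  have [FM _] := FP _ e1.
  have [x [u [eE es xM _]]] := O1P _ e1; have [y [v [fE fs yM _]]] := O1P _ f1.
  have def : [disjoint e & f].
    by move: e1 f1; rewrite !inE => /andP[eO _] /andP[fO _]; apply: (trivIsetP tO).
  move: (def); rewrite eE fE disjoint_set2 !inE !negb_or.
  case/andP=> /andP[xy xv] /andP[uy uv].
  have uF : u \in F e by rewrite eE; apply: FE; rewrite -?eE.
  have vF : v \in F e by rewrite eqF fE; apply: FE; rewrite -?fE.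
  have FeE : [set u; v] = F e.
    apply/eqP; rewrite eqEcard subUset !sub1set uF vF cards2 uv card2 //.
    exact: (subsetP sM).
  have inc z : z \in F e -> z \in cover M by apply/subsetP/sub_cover.
  have /negP[] := noaug x u v y.
  rewrite aug3E FeE -eE setUC -fE es fs (subsetP sM) // FM xM yM /= !inE !negb_or.
  rewrite xv xy uv uy !andbT /=.
  apply/andP; split; [apply: contraNneq xM => -> | apply: contraNneq yM => <-];
    exact: inc.
(* Edges of [O] are disjoint, so the sum counts each vertex of [cover M] at most once. *)
have ltO : \sum_(e in O) #|e :&: cover M| <= 2 * #|M|.
  have -> : \sum_(e in O) #|e :&: cover M| = \sum_(x in cover O) (x \in cover M).
    rewrite (big_trivIset (op := addn) _ tO); apply: eq_bigr => e _.
    rewrite -sum1_card big_mkcond [RHS]big_mkcond; apply: eq_bigr => x _.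
    by rewrite inE; case: (x \in e); case: (x \in cover M).
  apply: (@leq_trans #|cover M|).
    rewrite -sum1_card big_mkcond [X in _ <= X]big_mkcond; apply: leq_sum => x _.
    by case: (x \in cover O); case: (x \in cover M).
  apply: leq_trans (leq_card_cover M) _.
  rewrite mulnC -sum_nat_const; apply: leq_sum => m /(subsetP sM) ms.
  by rewrite card2.
have -> : 3 * #|M| = 2 * #|M| + #|M| by rewrite -[3]/(2 + 1) mulnDl mul1n.
apply: leq_trans (leq_add ltO leO1).
have -> : #|O1| = \sum_(e in O) ~~ (e \subset cover M).
  rewrite -sum1_card big_mkcond [RHS]big_mkcond; apply: eq_bigr => e _.
  by rewrite inE; case: (e \in O); case: (e \subset _).
rewrite -big_split mulnC -sum_nat_const /=; apply: leq_sum => e eO.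
case: (boolP (e \subset cover M)) => [/setIidPl -> | eM].
  by rewrite addn0 card2 // (subsetP sO).
have [x [u [-> _ _ uM]]] : exists x u,
    [/\ e = [set x; u], e \in s, x \notin cover M & u \in cover M].
  by apply: O1P; rewrite inE eO.
by rewrite addn1 ltnS card_gt0; apply/set0Pn; exists u; rewrite !inE eqxx orbT.
Qed.

End Augmentation.

Theorem theorem9 (V : finType) (r : path_rule V) (hr : correct_rule r) :
  late_accept_reject (algorithm2 r) /\
  strictly_competitive (3 / 2)%R (algorithm2 r).
Proof.
split=> s ins; have stM := algorithm2_stable hr ins.
  split=> [|e /(late_rejected_barred hr ins) /and3P[] //]; by case: stM.
have opt : 2 * OPT s <= 3 * #|algorithm2 r s|.
  (* The bound for single matchings passes to their maximum. *)
  rewrite /OPT; apply: (big_ind (fun n => 2 * n <= _)) => //.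
    by move=> m n lem len; rewrite maxnMr geq_max lem.
  by move=> O; apply: stable_card.
by rewrite mulrAC ler_pdivlMr // -!natrM ler_nat mulnC.
Qed.
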